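(* Let $H$ be an infinite-dimensional separable complex Hilbert space. Then there exists a non-standard map $\phi : P_\infty(H) \to P_\infty(H)$ satisfying $$\inf\{\angle(x,y) : x \in \mathrm{Im}\,P,\ y \in \mathrm{Im}\,Q,\ \|x\|=\|y\|=1\} = \inf\{\angle(x,y) : x \in \mathrm{Im}\,\phi(P),\ y \in \mathrm{Im}\,\phi(Q),\ \|x\|=\|y\|=1\}$$ for every $P,Q \in P_\infty(H)$.
   Context: ''Projection'' means orthogonal projection (bounded self-adjoint idempotent). $P_\infty(H)$ is the set of all projections on $H$ whose image and kernel are both infinite-dimensional; $\mathrm{Im}\,P$ is the image of $P$. For unit vectors $x,y\in H$, $\angle(x,y) = \arccos|\langle x,y\rangle| \in [0,\pi/2]$. A map $\phi : P_\infty(H)\to P_\infty(H)$ is called standard if there exists a linear or conjugate-linear isometry $U:H\to H$ such that $\phi(P) = UPU^\ast$ for all $P\in P_\infty(H)$; it is non-standard if no such $U$ exists. Here a linear isometry is a (not necessarily surjective) linear map with $\langle Ux,Uy\rangle = \langle x,y\rangle$ for all $x,y$; a conjugate-linear isometry is a (not necessarily surjective) conjugate-linear map with $\langle Ux,Uy\rangle = \langle y,x\rangle$ for all $x,y$. For conjugate-linear $U$, $U^\ast$ is the conjugate-linear map with $\langle Ux,y\rangle = \overline{\langle x,U^\ast y\rangle}$. In both cases, $UPU^\ast$ is the orthogonal projection onto $U(\mathrm{Im}\,P)$. *)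

(* Defs.v *)
From mathcomp Require Import all_boot all_order all_algebra.
From mathcomp Require Import all_classical all_reals all_analysis.
From mathcomp Require Import complex.
Set Implicit Arguments.
Unset Strict Implicit.
Unset Printing Implicit Defensive.
Import Order.TTheory GRing.Theory Num.Theory.
Import numFieldNormedType.Exports.
Local Open Scope classical_set_scope.
Local Open Scope ring_scope.

Definition lin_span (K : nzRingType) (V : lmodType K) (s : seq V) : set V :=
  [set v | exists c : 'I_(size s) -> K, v = \sum_(i < size s) c i *: s`_i].

Definition infinite_dim (K : nzRingType) (V : lmodType K) (A : set V) : Prop :=
  ~ exists s : seq V, A = lin_span s.

Definition separable_space (T : topologicalType) : Prop :=
  exists D : set T, countable D /\ dense D.

(* A complex Hilbert space is a complete normed module H over R[i], with
   R : realType, together with an inner product ip : {dot H for Num.conj}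
   satisfying `|x| ^+ 2 = ip x x. Such an ip is linear in its first argument
   and conjugate-linear in the second. *)
Section Hilbert.
Variables (R : realType) (H : completeNormedModType R[i]).
Variable ip : {dot H for Num.conj}.

Definition bounded_op (T : H -> H) : Prop :=
  exists M : R, forall x : H, `|T x| <= M%:C%C * `|x|.

Definition self_adjoint (T : H -> H) : Prop :=
  forall x y : H, ip (T x) y = ip x (T y).

Definition is_projection (P : H -> H) : Prop :=
  [/\ bounded_op P, self_adjoint P & idempotent_fun P].

Record Pinfty := MkPinfty {
  Pinfty_op :> {linear H -> H};
  Pinfty_proj : is_projection Pinfty_op;
  Pinfty_im : infinite_dim (range Pinfty_op);
  Pinfty_ker : infinite_dim (Pinfty_op @^-1` [set 0])
}.

Definition angle (x y : H) : R := acos (ComplexField.Normc.normc (ip x y)).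

Definition min_angle (P Q : H -> H) : R :=
  inf [set a | exists x y : H,
    [/\ range P x, range Q y, `|x| = 1, `|y| = 1 & a = angle x y]].

(* The adjoints Us below exist and are unique by the Riesz representation
   theorem, so quantifying over them is only a way of naming U^*. *)
Definition standard_linear (phi : Pinfty -> Pinfty) : Prop :=
  exists U Us : {linear H -> H},
    [/\ forall x y, ip (U x) (U y) = ip x y,
        forall x y, ip (U x) y = ip x (Us y) &
        forall (P : Pinfty) x, phi P x = U (P (Us x))].

Definition standard_conj_linear (phi : Pinfty -> Pinfty) : Prop :=
  exists U Us : {linear H -> H | Num.conj \; *:%R},
    [/\ forall x y, ip (U x) (U y) = ip y x,
        forall x y, ip (U x) y = (ip x (Us y))^* &
        forall (P : Pinfty) x, phi P x = U (P (Us x))].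

Definition standard (phi : Pinfty -> Pinfty) : Prop :=
  standard_linear phi \/ standard_conj_linear phi.

End Hilbert.

(* Main.v *)
(* The minimal angle of P and Q is arccos ||PQ||. Let (e_n) be an orthonormal
   sequence and U the isometry shifting it, e_n |-> e_(n+1), and fixing its
   orthogonal complement, so that e_0 is orthogonal to the range of U. Fix one
   P_0 in P_infty and put phi(P) = U P U^* for P <> P_0, while
   phi(P_0) = U P_0 U^* + |e_0><e_0|. The extra direction e_0 is only seen by
   the pair (P_0, P_0), whose minimal angle is 0 anyway, so phi preserves
   minimal angles. If phi(P) = W P W^* held for all P, then e_0 = W x for some
   x in the image of P_0; but some P <> P_0 also has x in its image, whence e_0
   would lie in the image of phi(P), which is contained in the range of U. *)
From HB Require Import structures.
Require Import Defs.
From mathcomp Require Import all_boot all_order all_algebra.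
From mathcomp Require Import all_classical all_reals all_analysis.
From mathcomp Require Import complex.
Set Implicit Arguments.
Unset Strict Implicit.
Unset Printing Implicit Defensive.
Import Order.TTheory GRing.Theory Num.Theory.
Import numFieldNormedType.Exports.
Local Open Scope classical_set_scope.
Local Open Scope ring_scope.

(** * Inner product identities and the Cauchy-Schwarz inequality *)

Section InnerProduct.
Variables (R : realType) (H : completeNormedModType R[i]).
Variable ip : {dot H for Num.conj}.
Hypothesis norm_ip : forall x : H, `|x| ^+ 2 = ip x x.

Lemma ipC x y : ip x y = (ip y x)^*.
Proof. by rewrite -[RHS]mul1r -(expr0 (-1)); exact: (hermC ip). Qed.

Lemma ipBl x y z : ip (x - y) z = ip x z - ip y z.
Proof. exact: (linearBl ip). Qed.

Lemma ipBr z x y : ip z (x - y) = ip z x - ip z y.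
Proof. exact: (linearBr ip). Qed.

Lemma ipDl x y z : ip (x + y) z = ip x z + ip y z.
Proof. exact: (linearDl ip). Qed.

Lemma ipDr z x y : ip z (x + y) = ip z x + ip z y.
Proof. exact: (linearDr ip). Qed.

Lemma ip0l z : ip 0 z = 0.
Proof. exact: (linear0l ip). Qed.

Lemma ip0r z : ip z 0 = 0.
Proof. exact: (linear0r ip). Qed.

Lemma ipZl a x y : ip (a *: x) y = a * ip x y.
Proof. exact: (linearZl_LR ip). Qed.

Lemma ipZr a x y : ip x (a *: y) = a^* * ip x y.
Proof. exact: (linearZr_LR ip). Qed.

Lemma ip_suml I (r : seq I) P (F : I -> H) y :
  ip (\sum_(k <- r | P k) F k) y = \sum_(k <- r | P k) ip (F k) y.
Proof. exact: (linear_sumlz ip). Qed.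

Lemma ip_sumr I (r : seq I) P (F : I -> H) y :
  ip y (\sum_(k <- r | P k) F k) = \sum_(k <- r | P k) ip y (F k).
Proof. exact: (linear_sumr ip). Qed.

Lemma norm_sqrD x y : ip x y = 0 -> `|x + y| ^+ 2 = `|x| ^+ 2 + `|y| ^+ 2.
Proof.
move=> xy; rewrite !norm_ip ipDl !ipDr xy (ipC y x) xy conjC0.
by rewrite addr0 add0r.
Qed.

Lemma ip_unit x : `|x| = 1 -> ip x x = 1.
Proof. by rewrite -norm_ip => ->; rewrite expr1n. Qed.

Lemma ip_injr x y : (forall z, ip z x = ip z y) -> x = y.
Proof.
move=> h; apply/eqP; rewrite -subr_eq0 -normr_eq0 -sqrf_eq0 norm_ip.
by rewrite ipBr h subrr.
Qed.

Lemma ip_injl x y : (forall z, ip x z = ip y z) -> x = y.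
Proof. by move=> h; apply: ip_injr => z; rewrite ipC h -ipC. Qed.

(** Pythagoras for [x = w + a *: y] with [w] orthogonal to [y]. *)
Lemma cauchy_schwarz x y : `|ip x y| <= `|x| * `|y|.
Proof.
have [->|y0] := eqVneq y 0; first by rewrite ip0r !normr0 mulr0.
have yy0 : ip y y != 0 by rewrite -norm_ip sqrf_eq0 normr_eq0.
have [a xyE] : exists a, ip x y = a * ip y y.
  by exists (ip x y / ip y y); rewrite divfK.
pose w := x - a *: y.
have wy : ip w y = 0 by rewrite ipBl ipZl xyE subrr.
have := @norm_sqrD w (a *: y); rewrite ipZr wy mulr0 subrK => /(_ erefl) h.
rewrite -ler_sqr ?nnegrE ?mulr_ge0// exprMn h xyE -norm_ip.
rewrite (normrZ a y) (normrM a) normrX normr_id !exprMn.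
rewrite mulrDl -mulrA -expr2 lerDr.
by rewrite mulr_ge0 ?exprn_ge0.
Qed.

(** * Orthonormal sequences and Bessel's inequality *)

Definition onseq (e : nat -> H) := forall i j, ip (e i) (e j) = (i == j)%:R.

Lemma onseq_unit e i : onseq e -> `|e i| = 1.
Proof.
by move=> eON; apply/eqP; rewrite -sqrp_eq1// norm_ip eON eqxx.
Qed.

Lemma onseq_comp e (s : nat -> nat) : injective s -> onseq e -> onseq (e \o s).
Proof. by move=> sI eON i j; rewrite /= eON (inj_eq sI). Qed.

Lemma ip_onseq_sum e n (c : 'I_n -> R[i]) (j : 'I_n) : onseq e ->
  ip (\sum_(k < n) c k *: e k) (e j) = c j.
Proof.
move=> eON; rewrite ip_suml (bigD1 j)//= ipZl eON eqxx mulr1.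
rewrite big1 ?addr0// => i ij.
by rewrite ipZl eON val_eqE (negPf ij) mulr0.
Qed.

Lemma norm_onseq_sum e m n (c : nat -> R[i]) : onseq e ->
  `|\sum_(m <= k < n) c k *: e k| ^+ 2 = \sum_(m <= k < n) `|c k| ^+ 2.
Proof.
move=> eON; have [nm|mn] := leqP n m.
  by rewrite !big_geq// normr0 expr0n.
rewrite -(subnKC (ltnW mn)); elim: (n - m)%N => [|d IH].
  by rewrite addn0 !big_geq// normr0 expr0n.
rewrite addnS !big_nat_recr ?leq_addr//= norm_sqrD ?IH; last first.
  rewrite ipZr ip_suml big_nat big1 ?mulr0// => i /andP[_ il].
  by rewrite ipZl eON (ltn_eqF il) mulr0.
by rewrite normrZ onseq_unit// mulr1.
Qed.

(** Pythagoras for [s] and [x - s], where [s] is the orthogonal projection of [x] onto the span of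
    the first [n] vectors. *)
Lemma bessel e n x : onseq e -> \sum_(k < n) `|ip x (e k)| ^+ 2 <= `|x| ^+ 2.
Proof.
move=> eON; pose s := \sum_(k < n) ip x (e k) *: e k.
have ws : ip (x - s) s = 0.
  rewrite {2}/s ip_sumr big1// => i _.
  by rewrite ipZr ipBl (ip_onseq_sum (fun k : 'I_n => ip x (e k)))// subrr mulr0.
have := norm_sqrD ws; rewrite subrK => ->.
rewrite /s -(big_mkord xpredT (fun k => ip x (e k) *: e k)) norm_onseq_sum//.
by rewrite !big_mkord lerDr exprn_ge0.
Qed.

(** * Partial isometries given by Fourier series *)

Lemma le0_of_eps (a b : R[i]) : 0 <= a -> 0 <= b ->
  (forall eps : R[i], 0 < eps -> a <= eps * b) -> a = 0.
Proof.
move=> a0 b0 h; have [//|an0] := eqVneq a 0.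
have a_gt0 : 0 < a by rewrite lt0r an0.
have b1 : 0 < b + 1 by rewrite ltr_wpDl.
(* This choice gives [b + 1 <= b]; the summand 1 keeps the denominator positive when [b = 0]. *)
have := h (a / (b + 1)) (divr_gt0 a_gt0 b1).
rewrite -mulrA ler_pMr// ler_pdivlMl// mulr1 gerDl => l10.
by have := lt_le_trans ltr01 l10; rewrite ltxx.
Qed.

(* The partial isometry sending e_k to f_k and killing the orthogonal complement
   of e; its adjoint is [fourier f e]. *)
Definition fourier (e f : nat -> H) (x : H) : H :=
  lim (series (fun k => ip x (e k) *: f k) @ \oo).

(** Norms take values in the partially ordered [R[i]], so the sums are carried to [R], where
    Bessel's inequality bounds them and monotone convergence applies. *)
Lemma square_sums_cauchy e x (eps : R[i]) : onseq e -> 0 < eps ->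
  exists N, forall m n, (N <= m <= n)%N ->
    \sum_(m <= k < n) `|ip x (e k)| ^+ 2 < eps.
Proof.
move=> eON eps0.
pose a k : R := ComplexField.Normc.normc (ip x (e k)) ^+ 2.
have aE k : `|ip x (e k)| ^+ 2 = (a k)%:C%C by rewrite /a rmorphXn.
have sE m n : \sum_(m <= k < n) `|ip x (e k)| ^+ 2 =
    (\sum_(m <= k < n) a k)%:C%C.
  by rewrite rmorph_sum; apply: eq_bigr => k _.
have a0 k : 0 <= a k by rewrite -lecR -aE exprn_ge0.
have inc : nondecreasing_seq (series a).
  by apply: nondecreasing_series => *; exact: a0.
have /complex_realP[M xM] : `|x| ^+ 2 \is Num.real.
  by rewrite ger0_real ?exprn_ge0.
have bnd n : series a n <= M.
  by rewrite -lecR -sE -xM big_mkord bessel.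
have cv : cvgn (series a).
  by apply: nondecreasing_is_cvgn => //; exists M => _ [n _ <-].
have le_lim := nondecreasing_cvgn_le inc cv.
have /complex_realP[d epsE] := gtr0_real eps0.
have d0 : 0 < d by move: eps0; rewrite epsE ltcR.
have /cvgrPdist_lt/(_ d d0)[N _ hN] := cv.
exists N => m n /andP[Nm mn]; rewrite sE epsE ltcR -[X in X < _]/(_).
have := hN m Nm; rewrite /= ger0_norm ?subr_ge0// => h.
have := sub_series a m n; rewrite mn => <-.
by apply: le_lt_trans h; rewrite lerB.
Qed.

(** By orthonormality of [f], the squared norm of a block of the series is a block of square sums of
    coefficients; completeness of [H] then gives the limit. *)
Lemma fourier_cvg e f x : onseq e -> onseq f ->
  series (fun k => ip x (e k) *: f k) @ \oo --> fourier e f x.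
Proof.
move=> eON fON; apply/cauchy_cvgP/cauchy_seriesP => eps eps0.
have [N hN] := square_sums_cauchy x eON (exprn_gt0 2 eps0).
near=> p; rewrite -ltr_sqr ?nnegrE ?(ltW eps0)//.
rewrite norm_onseq_sum//.
have [mn|/ltnW nm] := leqP p.1 p.2; last by rewrite big_geq ?exprn_gt0.
apply: hN; rewrite mn andbT; near: p.
exists ([set n | (N <= n)%N], setT) => /=; last by case=> a b /= [].
by split; [exists N|exact: filterT].
Unshelve. all: by end_near. Qed.

Lemma fourier_uniq e f x y : onseq e -> onseq f ->
  series (fun k => ip x (e k) *: f k) @ \oo --> y -> fourier e f x = y.
Proof. by move=> eON fON; apply: norm_cvg_unique; apply: fourier_cvg. Qed.

Lemma fourier_is_linear e f : onseq e -> onseq f -> linear (fourier e f).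
Proof.
move=> eON fON a x y; apply: fourier_uniq => //.
rewrite (_ : series _ = (fun n => a *: series (fun k => ip x (e k) *: f k) n
    + series (fun k => ip y (e k) *: f k) n)).
  by apply: cvgD; [apply: cvgZl_tmp|]; apply: fourier_cvg.
apply/funext => n; rewrite /series/= scaler_sumr -big_split/=.
by apply: eq_bigr => k _; rewrite ipDl ipZl scalerDl scalerA.
Qed.

(** The partial sums at a common index satisfy the identity exactly, and Cauchy-Schwarz bounds the
    truncation error by [eps * (|x| + |y|)]. *)
Lemma fourier_adj e f x y : onseq e -> onseq f ->
  ip (fourier e f x) y = ip x (fourier f e y).
Proof.
move=> eON fON; apply/eqP; rewrite -subr_eq0 -normr_eq0; apply/eqP.
have xy0 : 0 <= `|x| + `|y| by rewrite addr_ge0.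
apply: (le0_of_eps (normr_ge0 _) xy0) => eps eps0.
have /cvgrPdist_lt/(_ _ eps0) h1 := fourier_cvg (x := x) eON fON.
have /cvgrPdist_lt/(_ _ eps0) h2 := fourier_cvg (x := y) fON eON.
have [n [/= hx hy]] := filter_ex (filterI h1 h2).
set u := fourier e f x in hx *; set v := fourier f e y in hy *.
set s := series _ n in hx; set t := series _ n in hy.
have st : ip s y = ip x t.
  rewrite ip_suml ip_sumr; apply: eq_bigr => k _.
  by rewrite ipZl ipZr -ipC mulrC.
have -> : ip u y - ip x v = ip (u - s) y - ip x (v - t).
  by rewrite ipBl ipBr st opprB addrA subrK.
apply: (le_trans (ler_normB _ _)); rewrite addrC mulrDr.
apply: lerD; rewrite ?[eps * `|x|]mulrC; apply: (le_trans (cauchy_schwarz _ _)).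
  by rewrite ler_wpM2l// ltW.
by rewrite ler_wpM2r// ltW.
Qed.

Lemma fourier_basis e f k : onseq e -> onseq f -> fourier e f (e k) = f k.
Proof.
move=> eON fON; apply: fourier_uniq => //.
apply: cvg_near_cst; exists k.+1 => // n /= kn.
rewrite /series/= big_mkord (bigD1 (Ordinal kn))//= eON eqxx scale1r.
rewrite big1 ?addr0// => i ik.
by rewrite eON eq_sym -[k]/(val (Ordinal kn)) val_eqE (negPf ik) scale0r.
Qed.

Lemma fourier_eq0 e f x : onseq e -> onseq f ->
  (forall k, ip x (e k) = 0) -> fourier e f x = 0.
Proof.
move=> eON fON h; apply: fourier_uniq => //.
rewrite (_ : series _ = cst 0); first exact: cvg_cst.
by apply/funext => n; rewrite /series/= big1// => k _; rewrite h scale0r.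
Qed.

(** By adjointness, the coefficient of [fourier e f x] along [f k] is that of [x] along [e k], so
    both sides are limits of the same series. *)
Lemma fourier_comp e f g x : onseq e -> onseq f ->
  fourier f g (fourier e f x) = fourier e g x.
Proof.
move=> eON fON; rewrite /fourier -/(fourier e f x).
congr (lim (series _ @ \oo)); apply/funext => k.
by rewrite fourier_adj// fourier_basis.
Qed.

(** [fourier e e] is self-adjoint and fixes every [e (s k)], so applying it first does not change
    the coefficients along the subsequence. *)
Lemma fourier_proj e (s : nat -> nat) g x : injective s -> onseq e ->
  fourier (e \o s) g (fourier e e x) = fourier (e \o s) g x.
Proof.
move=> sI eON; rewrite /fourier -/(fourier e e x).
congr (lim (series _ @ \oo)); apply/funext => k.
by rewrite fourier_adj// fourier_basis.
Qed.

(** * Finite spans, infinite dimension and existence of orthonormal sequences *)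

Lemma lin_span_nil : lin_span [::] = [set 0 : H].
Proof.
apply/seteqP; split => [v [c ->]|v ->]; first by rewrite big_ord0.
by exists (fun=> 0); rewrite big_ord0.
Qed.

Lemma lin_span_map (f : {linear H -> H}) (s : seq H) :
  lin_span (map f s) = f @` lin_span s.
Proof.
have fE n (c : 'I_n -> R[i]) (ts : n = size s) :
    \sum_(i < n) c i *: (map f s)`_i = f (\sum_(i < n) c i *: s`_i).
  rewrite linear_sum; apply: eq_bigr => i _.
  by rewrite linearZ (nth_map 0)// -ts.
apply/seteqP; split => v.
  case; rewrite size_map => c ->; rewrite fE//.
  by eexists; [exists c|].
by case=> _ [c ->] <-; red => /=; rewrite size_map; exists c; rewrite fE.
Qed.

Lemma infinite_dim_image (f : {linear H -> H}) (A B : set H) :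
  f @` A = B -> infinite_dim B -> infinite_dim A.
Proof.
move=> fAB Binf [s As]; apply: Binf.
by exists (map f s); rewrite lin_span_map -As.
Qed.

(** If [N] vectors spanned [A], the first [N + 1] terms of [e] would satisfy a nontrivial linear
    relation, read off the kernel of their coefficient matrix; pairing with [e j] kills each
    coefficient. *)
Lemma onseq_infinite_dim (A : set H) e : onseq e -> (forall n, A (e n)) ->
  infinite_dim A.
Proof.
move=> eON Ae [s As]; pose N := size s.
have /choice[c cE] : forall n, exists c : 'I_N -> R[i],
    e n = \sum_(i < N) c i *: s`_i by move=> n; move: (Ae n); rewrite As.
pose C := \matrix_(i < N.+1, j < N) c i j.
have /rowV0Pn[u /sub_kermxP uC u0] : kermx C != 0.
  by rewrite kermx_eq0 /row_free ltn_eqF// ltnS rank_leq_col.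
case/eqP: u0; apply/rowP => j; rewrite mxE.
rewrite -(ip_onseq_sum (u 0) j eON).
rewrite (eq_bigr (fun i : 'I_N.+1 => \sum_(l < N) (u 0 i * C i l) *: s`_l));
    last first.
  move=> i _; rewrite cE scaler_sumr; apply: eq_bigr => l _.
  by rewrite scalerA mxE.
rewrite exchange_big big1 ?ip0l// => l _; rewrite -scaler_suml.
have := congr1 (fun M : 'rV_N => M 0 l) uC; rewrite !mxE => ->.
by rewrite scale0r.
Qed.

(** Greedy construction: [L n] lists the first [n] vectors, and [e n] is any unit vector orthogonal
    to them. The default [0] of [xget] is ruled out by strong induction. *)
Lemma onseq_exists : infinite_dim [set: H] -> exists e, onseq e.
Proof.
move=> Hinf.
pose good (s : seq H) v := `|v| = 1 /\ forall w, w \in s -> ip v w = 0.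
pose pick s : H := xget 0 (good s).
pose L := fix L n := if n is m.+1 then rcons (L m) (pick (L m)) else [::].
pose e n := pick (L n).
have L_mem m n : (m < n)%N -> e m \in L n.
  elim: n => // n IH; rewrite ltnS leq_eqVlt => /predU1P[->|/IH mn] /=.
    by rewrite mem_rcons mem_head.
  by rewrite mem_rcons inE mn orbT.
have LE n : L n = map e (iota 0 n).
  by elim: n => // n IH; rewrite -[in RHS]addn1 iotaD map_cat -IH cats1.
suff eP n : good (L n) (e n).
  have e0 i j : (i < j)%N -> ip (e j) (e i) = 0.
    by move=> ij; apply: (eP j).2; exact: L_mem.
  move=> *; exists e => i j; case: ltngtP => [ij|ji|->].
  - by rewrite ipC e0// conjC0.
  - by rewrite e0.
  - by rewrite ip_unit// (eP j).1.
elim/ltn_ind: n => n IH.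
(* If no such vector exists, every Gram-Schmidt remainder [w] vanishes, and [L n] spans [H]. *)
rewrite /e /pick; case: xgetP => // nogood; exfalso; apply: Hinf.
exists (L n); apply/seteqP; split => // v _.
have eON i j : (i < n)%N -> (j < n)%N -> ip (e i) (e j) = (i == j)%:R.
  move=> iN jN; case: ltngtP => [ij|ji|->].
  - by rewrite ipC (IH _ jN).2 ?conjC0// L_mem.
  - by rewrite (IH _ iN).2// L_mem.
  - by rewrite ip_unit// (IH _ jN).1.
pose w := v - \sum_(i < n) ip v (e i) *: e i.
have wL u : u \in L n -> ip w u = 0.
  rewrite LE => /mapP[j]; rewrite mem_iota add0n /= => jn ->.
  rewrite ipBl ip_suml (bigD1 (Ordinal jn))//= ipZl eON// eqxx mulr1.
  rewrite big1 ?addr0 ?subrr// => i ij.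
  by rewrite ipZl eON// -[j]/(val (Ordinal jn)) val_eqE (negPf ij) mulr0.
have [w0|w0] := eqVneq w 0.
  have nE : size (L n) = n by rewrite LE size_map size_iota.
  red => /=; rewrite nE; exists (fun i => ip v (e i)).
  rewrite -[LHS](subrK (\sum_(i < n) ip v (e i) *: e i)) -/w w0 add0r.
  apply: eq_bigr => i _.
  by rewrite LE (nth_map 0%N) ?size_iota// nth_iota// add0n.
case: (nogood (`|w|^-1 *: w)); split => [|u uL].
  by rewrite normrZ normfV normr_id mulVf ?normr_eq0.
by rewrite ipZl wL// mulr0.
Qed.

(** * Construction of linear maps, of elements of [Pinfty], and of the shift *)

Lemma linear_exists (f : H -> H) : linear f ->
  exists g : {linear H -> H}, forall x, g x = f x.
Proof.
move=> lf; pose m := GRing.isLinear.Build R[i] H H _ f lf.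
pose g : {linear H -> H} := HB.pack f m.
by exists g.
Qed.

Lemma Pinfty_exists (f : H -> H) : linear f ->
  (forall x y, ip (f x) y = ip x (f y)) -> (forall x, f (f x) = f x) ->
  infinite_dim (range f) -> infinite_dim (f @^-1` [set 0]) ->
  exists P : Pinfty ip, forall x, P x = f x.
Proof.
move=> /linear_exists[g gE]; have {gE} <- : (g : H -> H) = f by apply/funext.
move=> sa idem im ker; suff pr : is_projection ip g by exists (MkPinfty pr im ker).
split=> //.
(* Self-adjointness and idempotence turn the square of [|g x|] into [ip (g x) x], so Cauchy-Schwarz
   gives the bound 1. *)
exists 1 => x; rewrite mul1r; have [->|gx0] := eqVneq (g x) 0.
  by rewrite normr0.
rewrite -(@ler_pM2l _ `|g x|) ?normr_gt0// -expr2 norm_ip sa idem -sa.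
rewrite -[X in X <= _]ger0_norm ?cauchy_schwarz//.
by rewrite sa -idem -sa -norm_ip exprn_ge0.
Qed.

Lemma fourier_Pinfty e f : onseq e -> onseq f ->
  (forall i j, ip (f i) (e j) = 0) ->
  exists P : Pinfty ip, forall x, P x = fourier e e x.
Proof.
move=> eON fON fe; apply: Pinfty_exists.
- exact: fourier_is_linear.
- by move=> x y; rewrite fourier_adj.
- by move=> x; rewrite fourier_comp.
- apply: (onseq_infinite_dim eON) => n.
  by exists (e n) => //; rewrite fourier_basis.
- by apply: (onseq_infinite_dim fON) => n; rewrite /= fourier_eq0.
Qed.

(** [P] and [Q] project onto the closed spans of the [e (4 n)] and of the [e (2 n)]; the odd-indexed
    vectors make both kernels infinite-dimensional. *)
Lemma nested_Pinfty_exist e : onseq e ->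
  exists P Q : Pinfty ip, P <> Q /\ forall x, Q (P x) = P x.
Proof.
move=> eON.
pose s4 n := (n * 4)%N; pose s2 n := (n * 2)%N; pose s1 n := (n * 2).+1.
have s4I : injective s4 by move=> i j /eqP; rewrite eqn_pmul2r// => /eqP.
have s2I : injective s2 by move=> i j /eqP; rewrite eqn_pmul2r// => /eqP.
have s1I : injective s1 by move=> i j [] /s2I.
have odd_even i j : ip (e (s1 i)) (e (s2 j)) = 0.
  rewrite eON; case: eqP => // /(congr1 odd).
  by rewrite /s1 /s2/= !muln2 !odd_double.
have [g4 g2] := (onseq_comp s4I eON, onseq_comp s2I eON).
have g1 := onseq_comp s1I eON.
have s42 n : s4 n = s2 (s2 n) by rewrite /s4 /s2 -mulnA.
have [P PE] := @fourier_Pinfty (e \o s4) (e \o s1) g4 g1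
  (fun i j => etrans (congr1 (fun k => ip (e (s1 i)) (e k)) (s42 j))
     (odd_even i (s2 j))).
have [Q QE] := @fourier_Pinfty (e \o s2) (e \o s1) g2 g1 odd_even.
exists P, Q; split.
  (* The vector [e 2] is fixed by [Q] and killed by [P]. *)
  move=> PQ; have e2 : `|e 2%N| = 1 by exact: onseq_unit.
  have := PE (e 2%N); rewrite PQ QE (fourier_basis 1 g2 g2).
  rewrite fourier_eq0// => [/= h|k].
    by move/eqP: e2; rewrite -[2%N]/(s2 1%N) h normr0 eq_sym oner_eq0.
  by rewrite eON; case: k.
move=> x; rewrite QE PE; apply: ip_injl => y.
rewrite !fourier_adj//; congr (ip x _).
have -> : e \o s4 = (e \o s2) \o s2 by apply/funext => k /=; rewrite s42.
exact: fourier_proj.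
Qed.

(** With [E] the projection onto the closed span of [e] and [S] the partial isometry sending [e k]
    to [e k.+1], the maps are [U = 1 - E + S] and [Us = 1 - E + S^*]. *)
Lemma shift_exists e : onseq e -> exists U Us : {linear H -> H},
  [/\ forall x y, ip (U x) y = ip x (Us y), forall x, Us (U x) = x &
      Us (e 0%N) = 0].
Proof.
move=> eON; have fON := onseq_comp succn_inj eON; pose f := e \o succn.
have lin g h : onseq g -> onseq h -> 
    linear (fun x => x - fourier e e x + fourier g h x).
  move=> gON hON a x y; rewrite !fourier_is_linear//.
  by rewrite /= scalerDr scalerBr opprD (addrACA (a *: x)) [LHS]addrACA.
have [U UE] := linear_exists (lin e f eON fON).
have [Us UsE] := linear_exists (lin f e fON eON).
have adj x y : ip (U x) y = ip x (Us y).
  by rewrite UE UsE ipDl ipBl ipDr ipBr !fourier_adj.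
exists U, Us; split => //; last first.
  by rewrite UsE fourier_basis// subrr add0r fourier_eq0// => k; rewrite eON.
  move=> x.
have UxE g h : onseq g -> onseq h -> fourier g h (U x) =
    fourier g h x - fourier g h (fourier e e x) + fourier g h (fourier e f x).
  move=> gON hON; have [F FE] := linear_exists (fourier_is_linear gON hON).
  by rewrite -!FE UE linearD linearB.
(* [E S = S], obtained from the adjoint identity [S^* E = S^*]. *)
have pt : fourier e e (fourier e f x) = fourier e f x.
  by apply: ip_injl => y; rewrite !fourier_adj// fourier_proj//; exact: succn_inj.
rewrite UsE !UxE// pt !fourier_comp// fourier_proj//; last exact: succn_inj.
rewrite UE subrr add0r addrK subrr add0r.
by rewrite subrK.
Qed.

(** * Angles decrease as the modulus of the inner product grows *)

Lemma le_acos (s t : R) : 0 <= s -> s <= t -> t <= 1 -> acos t <= acos s.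
Proof.
move=> s0 st t1.
have bnd (r : R) : 0 <= r -> r <= 1 -> -1 <= r <= 1.
  by move=> r0 ->; rewrite (le_trans _ r0)// oppr_le0.
have [ts ss] := (bnd t (le_trans s0 st) t1, bnd s s0 (le_trans st t1)).
have mem (r : R) : -1 <= r <= 1 -> acos r \in `[0, pi].
  by move=> ?; rewrite in_itv/= acos_ge0 ?acos_lepi.
rewrite leNgt -ltr_cos ?mem// !acosK ?in_itv//=.
by rewrite -leNgt.
Qed.

Lemma angle_anti (x y u v : H) : `|u| = 1 -> `|v| = 1 ->
  `|ip x y| <= `|ip u v| -> angle ip u v <= angle ip x y.
Proof.
move=> u1 v1; rewrite lecR => h; apply: le_acos => //.
  by rewrite -lecR; exact: (normr_ge0 (ip x y)).
by have := cauchy_schwarz u v; rewrite u1 v1 mulr1 -[1]/(1%:C%C) lecR.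
Qed.

Lemma angle_ge0 (x y : H) : `|x| = 1 -> `|y| = 1 -> 0 <= angle ip x y.
Proof.
move=> x1 y1; rewrite -acos1.
have <- : angle ip x x = acos 1.
  by rewrite /angle ip_unit// ComplexField.Normc.normc1.
apply: angle_anti => //; rewrite (ip_unit x1) normr1.
by rewrite (le_trans (cauchy_schwarz _ _))// x1 y1 mulr1.
Qed.

(** * Unit vectors in the image of a projection, and comparison of infima *)

Section Pinfty.
Variable P : Pinfty ip.

Lemma Pinfty_idem x : P (P x) = P x.
Proof. by have [_ _ idem] := Pinfty_proj P; exact: idem. Qed.

Lemma Pinfty_sa x y : ip (P x) y = ip x (P y).
Proof. by have [_ sa _] := Pinfty_proj P. Qed.

Lemma Pinfty_fix x : range P x -> P x = x.
Proof. by case=> y _ <-; exact: Pinfty_idem. Qed.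

Lemma Pinfty_unit : exists2 x, range P x & `|x| = 1.
Proof.
apply: contrapT => no; case: (@Pinfty_im _ _ _ P); exists [::].
rewrite lin_span_nil; apply/seteqP; split => [x Px|x ->]; last first.
  by exists 0; rewrite // linear0.
apply: contrapT => /eqP x0; apply: no; exists (`|x|^-1 *: x).
  by exists (`|x|^-1 *: x); rewrite // linearZ/= Pinfty_fix.
by rewrite normrZ normfV normr_id mulVf ?normr_eq0.
Qed.

(** For [x = 0] any unit vector of the image serves, which spares later arguments a case
    distinction. *)
Lemma Pinfty_direction x : range P x ->
  exists u, [/\ range P u, `|u| = 1 & x = `|x| *: u].
Proof.
move=> Px; have [->|x0] := eqVneq x 0.
  by have [u Pu u1] := Pinfty_unit; exists u; rewrite normr0 scale0r.
exists (`|x|^-1 *: x); split.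
- by exists (`|x|^-1 *: x); rewrite // linearZ/= Pinfty_fix.
- by rewrite normrZ normfV normr_id mulVf ?normr_eq0.
- by rewrite scalerA divff ?normr_eq0// scale1r.
Qed.
End Pinfty.

Lemma inf_eq_dominated (A B : set R) : A !=set0 -> A `<=` B -> lbound B 0 ->
  (forall b, B b -> exists2 a, A a & a <= b) -> inf A = inf B.
Proof.
move=> A0 AB B0 dom.
have lA : has_lbound A by exists 0 => a /AB; exact: B0.
have lB : has_lbound B by exists 0.
apply/eqP; rewrite eq_le; apply/andP; split.
  apply: lb_le_inf; first by case: A0 => a /AB; exists a.
  by move=> b /dom[a Aa ab]; apply: le_trans ab; apply: ge_inf.
by apply: lb_le_inf => // a /AB; apply: ge_inf.
Qed.

(** * Conjugation by an isometry, with an optional extra direction *)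

Section Twist.
Variables (U Us : {linear H -> H}) (u0 : H).
Hypothesis adjU : forall x y, ip (U x) y = ip x (Us y).
Hypothesis UK : forall x, Us (U x) = x.
Hypothesis u0_unit : `|u0| = 1.
Hypothesis Us_u0 : Us u0 = 0.

(** This is [U P U^* + c |u0><u0|]; the Boolean [c] switches the rank-one term, so that both kinds
    of value of the map are treated together. *)
Definition twist (c : bool) (P : H -> H) (x : H) : H :=
  U (P (Us x)) + (c%:R * ip x u0) *: u0.

Lemma adjUs x y : ip (Us x) y = ip x (U y).
Proof. by rewrite ipC -adjU -ipC. Qed.

Lemma twist_ip c (P : H -> H) x : ip (twist c P x) u0 = c%:R * ip x u0.
Proof. by rewrite ipDl adjU Us_u0 ip0r add0r ipZl ip_unit ?mulr1. Qed.

Lemma Us_twist c (P : H -> H) x : Us (twist c P x) = P (Us x).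
Proof. by rewrite linearD linearZ/= Us_u0 scaler0 addr0 UK. Qed.

Lemma twist_U c (P : H -> H) x : twist c P (U x) = U (P x).
Proof. by rewrite /twist adjU Us_u0 ip0r mulr0 scale0r addr0 UK. Qed.

Lemma normU x : `|U x| = `|x|.
Proof.
by apply/eqP; rewrite -(eqrXn2 (n := 2))// !norm_ip adjU UK.
Qed.

Lemma normUs x : `|Us x| <= `|x|.
Proof.
have [->|Ux0] := eqVneq (Us x) 0; first by rewrite normr0.
rewrite -(@ler_pM2l _ `|Us x|) ?normr_gt0// -expr2 norm_ip -adjU.
rewrite -[X in X <= _]ger0_norm; last by rewrite adjU -norm_ip exprn_ge0.
by rewrite (le_trans (cauchy_schwarz _ _))// normU.
Qed.

Lemma twist_idem c (P : Pinfty ip) x : twist c P (twist c P x) = twist c P x.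
Proof.
rewrite {1}/twist Us_twist twist_ip Pinfty_idem mulrA -natrM.
by case: c.
Qed.

(** [Us] maps the image and the kernel of the twisted operator onto those of [P], so both remain
    infinite-dimensional. *)
Lemma twist_Pinfty c (P : Pinfty ip) :
  exists Q : Pinfty ip, forall x, Q x = twist c P x.
Proof.
apply: Pinfty_exists.
- move=> a x y; rewrite /twist !linearP/= ipDl ipZl mulrDr scalerDl scalerDr.
  by rewrite addrACA scalerA mulrCA.
- move=> x y; rewrite /twist ipDl ipDr adjU Pinfty_sa adjUs; congr (_ + _).
  by rewrite ipZl ipZr rmorphM/= conjC_nat -ipC mulrAC.
- exact: twist_idem.
- apply: (@infinite_dim_image Us _ (range P)); last exact: Pinfty_im.
  apply/seteqP; split => y.
    by case=> _ [x _ <-] <-; rewrite Us_twist; exists (Us x).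
  by case=> x _ <-; exists (twist c P (U x)); [exists (U x)|rewrite twist_U UK].
- apply: (@infinite_dim_image Us _ (P @^-1` [set 0])); last exact: Pinfty_ker.
  apply/seteqP; split => y /=.
    by case=> x + <-; rewrite -(Us_twist c) => ->; rewrite linear0.
  by move=> Py; exists (U y); rewrite ?UK// twist_U Py linear0.
Qed.

Lemma min_angle_twist c d (P Q : Pinfty ip) : (c && d -> P = Q) ->
  min_angle ip P Q = min_angle ip (twist c P) (twist d Q).
Proof.
move=> cdPQ; apply: inf_eq_dominated.
- have [[x Px x1] [y Qy y1]] := (Pinfty_unit P, Pinfty_unit Q).
  by exists (angle ip x y), x, y.
- move=> _ [x [y [Px Qy x1 y1 ->]]]; exists (U x), (U y); split.
  + by exists (U x); rewrite // twist_U Pinfty_fix.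
  + by exists (U y); rewrite // twist_U Pinfty_fix.
  + by rewrite normU.
  + by rewrite normU.
  + by rewrite /angle adjU UK.
- by move=> _ [x [y [_ _ x1 y1 ->]]]; exact: angle_ge0.
move=> _ [x [y [[x' _ xE] [y' _ yE] x1 y1 ->]]].
have [cd|ncd] := boolP (c && d).
  (* Both operators carry the extra direction, so [P = Q], and the pair [u], [u] already attains the
     smallest possible angle. *)
  have [u Pu u1] := Pinfty_unit P.
  exists (angle ip u u); first by exists u, u; rewrite -(cdPQ cd).
  apply: angle_anti => //; rewrite (ip_unit u1) normr1.
  by rewrite (le_trans (cauchy_schwarz _ _))// x1 y1 mulr1.
have PUx : P (Us x) = Us x by rewrite -xE Us_twist Pinfty_idem.
have QUy : Q (Us y) = Us y by rewrite -yE Us_twist Pinfty_idem.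
(* The [u0] components contribute a term with factor [c * d], which is zero here, and the cross
   terms vanish because [Us u0 = 0]. *)
have xyE : ip x y = ip (Us x) (Us y).
  rewrite -{1}xE -twist_idem xE /twist PUx -{1}yE -twist_idem yE /twist QUy.
  rewrite ipDl !ipDr !ipZl !ipZr !adjU !UK Us_u0 !ip0r mulr0 addr0.
  rewrite (ipC u0) adjU Us_u0 ip0r conjC0 mulr0 add0r.
  by move: ncd; case: c d {cdPQ xE yE} => -[]; rewrite // !mul0r
    ?conjC0 ?mul0r ?mulr0 addr0.
have [u [Pu u1 uE]] : exists u, [/\ range P u, `|u| = 1 & Us x = `|Us x| *: u].
  by apply: Pinfty_direction; exists (Us x).
have [v [Qv v1 vE]] : exists v, [/\ range Q v, `|v| = 1 & Us y = `|Us y| *: v].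
  by apply: Pinfty_direction; exists (Us y).
exists (angle ip u v); first by exists u, v.
(* Since [|Us x|] and [|Us y|] are at most 1, normalizing these vectors can only increase the
   modulus of the inner product. *)
apply: angle_anti => //; rewrite xyE uE vE ipZl ipZr !normrM norm_conjC !normr_id.
have [Ux1 Uy1] : `|Us x| <= 1 /\ `|Us y| <= 1 by rewrite -{1}x1 -{1}y1 !normUs.
by rewrite mulrA -[leRHS]mul1r ler_wpM2r// mulr_ile1.
Qed.

(** Only [Ws (W x) = x] is asked of [W] and [Ws], so the linear and conjugate-linear cases are
    covered at once. As [u0 = W (P (Ws u0))] and [Q P = P], the map [phi Q] would fix [u0], whereas
    the untwisted value sends it to 0. *)
Lemma twist_nonstandard (phi : Pinfty ip -> Pinfty ip) (P Q : Pinfty ip)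
    (W Ws : H -> H) : (forall x, Q (P x) = P x) ->
  (forall x, phi P x = twist true P x) ->
  (forall x, phi Q x = twist false Q x) ->
  (forall x, Ws (W x) = x) -> ~ forall (S : Pinfty ip) x, phi S x = W (S (Ws x)).
Proof.
move=> QP phiP phiQ WK phiW.
have u0E : W (P (Ws u0)) = u0.
  by rewrite -phiW phiP /twist Us_u0 !linear0 add0r mul1r ip_unit// scale1r.
have : phi Q u0 = u0.
  by rewrite phiW -{1}u0E WK QP.
rewrite phiQ /twist Us_u0 !linear0 mul0r scale0r addr0 => u00.
by move/eqP: u0_unit; rewrite -u00 normr0 eq_sym oner_eq0.
Qed.
End Twist.
End InnerProduct.

(** * Assembly of the non-standard map *)

Theorem proposition1p2 (R : realType) (H : completeNormedModType R[i])
    (ip : {dot H for Num.conj})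
    (norm_ip : forall x : H, `|x| ^+ 2 = ip x x)
    (infinite_dim_H : infinite_dim [set: H])
    (separable_H : separable_space H) :
  exists phi : Pinfty ip -> Pinfty ip,
    ~ standard phi /\
    forall P Q : Pinfty ip,
      min_angle ip P Q = min_angle ip (phi P) (phi Q).
Proof.
have [e eON] := onseq_exists norm_ip infinite_dim_H.
have [U [Us [adjU UK Use0]]] := shift_exists norm_ip eON.
have e01 := onseq_unit norm_ip 0 eON.
have [P [P' [PP' P'P]]] := nested_Pinfty_exist norm_ip eON.
(* The flag singles out [P], the smaller projection of the nested pair, as the only one receiving
   the extra direction [e 0]. *)
have /choice[phi phiE] := fun Q : Pinfty ip =>
  twist_Pinfty norm_ip adjU UK e01 Use0 `[< Q = P >] Q.
exists phi; split.
  have key (W Ws : H -> H) : (forall x, Ws (W x) = x) ->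
      ~ forall (S : Pinfty ip) x, phi S x = W (S (Ws x)).
    apply: (twist_nonstandard norm_ip e01 Use0 P'P).
    - by move=> x; rewrite phiE asboolT.
    - by move=> x; rewrite phiE asboolF// => /esym.
  (* In either case the isometry and adjoint identities make [Ws] a left inverse of [W]. *)
  case=> -[W [Ws [Wiso Wadj phiW]]]; apply: key phiW => x.
  - by apply: (ip_injr norm_ip) => z; rewrite -Wadj Wiso.
  - by apply: (ip_injr norm_ip) => z; rewrite -[LHS]conjCK -Wadj Wiso -ipC.
move=> Q S.
rewrite (min_angle_twist norm_ip adjU UK e01 Use0
  (c := `[< Q = P >]) (d := `[< S = P >])).
  by congr (min_angle ip _ _); apply/funext => x; rewrite phiE.
by move=> /andP[/asboolP -> /asboolP ->].
Qed.
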